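(* Let $q,p,r,s\in\mathbb C^\times$ with $q^2\ne1$, and let $\hat R\in\mathrm{End}(\mathbb C^4\otimes\mathbb C^4)$ be the $R$-matrix for the Belavin--Drinfeld triple $(\Pi_1,\Pi_2,\tau)=(\{\alpha_1\},\{\alpha_3\},\alpha_1\mapsto\alpha_3)$ of $\mathfrak{sl}(4)$, with arbitrary multiparameters $p,r,s$, i.e. the matrix whose entries $\hat R^{ij}_{kl}$ are read off from the relations $x^iy^j=\sum_{k,l}\hat R^{ij}_{kl}y^kx^l$ given by $$x^iy^i=y^ix^i\quad(i=1,2,3,4),$$ $$x^1y^2=\tfrac pq\,y^2x^1,\quad x^1y^3=\tfrac r{q^2}\,y^3x^1,\quad x^1y^4=\tfrac{pr}q\,y^4x^1-\tfrac{rs}q\,y^3x^2,$$ $$x^2y^1=\tfrac1{pq}\,y^1x^2+(1-q^{-2})y^2x^1,\quad x^2y^3=\tfrac s{pq}\,y^3x^2,\quad x^2y^4=\tfrac s{q^2}\,y^4x^2,$$ $$x^3y^1=\tfrac1r\,y^1x^3+(1-q^{-2})y^3x^1,\quad x^3y^2=\tfrac p{qs}\,y^2x^3+(1-q^{-2})y^3x^2,\quad x^3y^4=\tfrac{pr}{qs}\,y^4x^3,$$ $$x^4y^1=\tfrac1{pqr}\,y^1x^4+(1-q^{-2})y^4x^1+\tfrac1q\,y^2x^3,\quad x^4y^2=\tfrac1s\,y^2x^4+(1-q^{-2})y^4x^2,\quad x^4y^3=\tfrac s{pqr}\,y^3x^4+(1-q^{-2})y^4x^3 .$$ Then $\hat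 R$ cannot be rimed: there is no $A\in GL(4,\mathbb C)$ such that $(A\otimes A)\hat R(A^{-1}\otimes A^{-1})$ is a rime matrix.
   Context: Entries: $\hat R(e_k\otimes e_l)=\sum_{i,j}\hat R^{ij}_{kl}e_i\otimes e_j$ for the standard basis $e_1,\dots,e_4$; the symbols $y^kx^l$ are treated as linearly independent. A matrix $\hat R$ is a rime matrix if $\hat R^{ij}_{kl}\neq0$ implies $\{k,l\}\subset\{i,j\}$ (inclusion of sets). $\alpha_1,\alpha_2,\alpha_3$ are the simple positive roots of $\mathfrak{sl}(4)$ (the Belavin--Drinfeld description is only motivation; the matrix $\hat R$ is completely specified by the relations). *)

(* Defs.v *)
From mathcomp Require Import all_boot all_order all_algebra.
From mathcomp Require Import mxtens.

Set Implicit Arguments.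
Unset Strict Implicit.
Unset Printing Implicit Defensive.

Import GRing.Theory.
Local Open Scope ring_scope.

(* An endomorphism M of F^n (x) F^n is a matrix acting on column vectors, with
   e_i (x) e_j sitting at position mxtens_index (i, j), the indexing used by
   the Kronecker product A *t B.  Hence M^{ij}_{kl}, defined by
   M (e_k (x) e_l) = \sum_(i, j) M^{ij}_{kl} e_i (x) e_j, has (i, j) as row
   index and (k, l) as column index. *)
Definition tens_entry (F : fieldType) (n : nat) (M : 'M[F]_(n * n))
    (i j k l : 'I_n) : F :=
  M (mxtens_index (i, j)) (mxtens_index (k, l)).

Definition is_rime (F : fieldType) (n : nat) (M : 'M[F]_(n * n)) : Prop :=
  forall i j k l : 'I_n,
    tens_entry M i j k l != 0 -> [set k; l] \subset [set i; j].

(* The formal symbol y^k x^l, with 1 <= k, l <= 4, as a basis vector of F^16. *)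
Definition yx (F : fieldType) (k l : nat) : 'rV[F]_(4 * 4) :=
  delta_mx 0 (mxtens_index (inord k.-1 : 'I_4, inord l.-1 : 'I_4)).

(* The right-hand side of the relation x^i y^j = ..., with 1 <= i, j <= 4. *)
Definition xy (F : fieldType) (q p r s : F) (i j : nat) : 'rV[F]_(4 * 4) :=
  match i, j with
  | 1%N, 1%N => yx F 1 1
  | 1%N, 2%N => (p / q) *: yx F 2 1
  | 1%N, 3%N => (r / q ^+ 2) *: yx F 3 1
  | 1%N, 4%N => (p * r / q) *: yx F 4 1 - (r * s / q) *: yx F 3 2
  | 2%N, 1%N => (p * q)^-1 *: yx F 1 2 + (1 - q ^- 2) *: yx F 2 1
  | 2%N, 2%N => yx F 2 2
  | 2%N, 3%N => (s / (p * q)) *: yx F 3 2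
  | 2%N, 4%N => (s / q ^+ 2) *: yx F 4 2
  | 3%N, 1%N => r^-1 *: yx F 1 3 + (1 - q ^- 2) *: yx F 3 1
  | 3%N, 2%N => (p / (q * s)) *: yx F 2 3 + (1 - q ^- 2) *: yx F 3 2
  | 3%N, 3%N => yx F 3 3
  | 3%N, 4%N => (p * r / (q * s)) *: yx F 4 3
  | 4%N, 1%N => (p * q * r)^-1 *: yx F 1 4 + (1 - q ^- 2) *: yx F 4 1
              + q^-1 *: yx F 2 3
  | 4%N, 2%N => s^-1 *: yx F 2 4 + (1 - q ^- 2) *: yx F 4 2
  | 4%N, 3%N => (s / (p * q * r)) *: yx F 3 4 + (1 - q ^- 2) *: yx F 4 3
  | 4%N, 4%N => yx F 4 4
  | _, _ => 0
  end.

(* The row of index (i, j) collects the coefficients of x^i y^j on the y^k x^l;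
   ordinals are numbered from 0, hence the successors. *)
Definition Rhat (F : fieldType) (q p r s : F) : 'M[F]_(4 * 4) :=
  \matrix_(a < 4 * 4)
    xy q p r s (mxtens_unindex a).1.+1 (mxtens_unindex a).2.+1.

(* Main.v *)
Require Import Defs.
From mathcomp Require Import all_boot all_order all_algebra.
From mathcomp Require Import mxtens complex reals.
From mathcomp Require Import ring.

(** Write the rows of [A] as linear forms [f], so that riming [Rhat] by [A]
means rewriting the relations in the four independent coordinates
[f(x) = \sum_k a_k x^k].  The rime condition then says exactly that
[f(x) f(y)] is proportional to [f(y) f(x)] for each row, and that for two rows
[f] and [g] the product [f(x) g(y)] stays in the span of the four products of
[f, g] in [y] by [f, g] in [x] ([rime_square], [rime_pair]).  Both conditions
are explicit equations on the coordinates, and they are too strong for four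
independent rows to satisfy them.

For a single row, comparing the coefficients of [y^k x^k] shows that the factor
of proportionality is 1; comparing those of [y^k x^l], [k < l], then constrains
the parameters as soon as [a_k a_l != 0] ([fixed12] to [fixed34]).  The pair
[{2,3}] is special because of the Belavin-Drinfeld term, which couples it to
[{1,4}]: [a_2 a_3 (q s - p) = s a_1 a_4] ([fixed23]).  There are two cases.

- Some row [a] has [a_1 a_4 != 0].  Then all its coordinates are nonzero, which
  forces [p = 1/q] and [r = s = 1], and [a] lies on the smooth quadric
  [x_1 x_4 = (q - 1/q) x_2 x_3].  For these parameters the pair condition
  between [a] and any row [b] makes [b] orthogonal to [a] for the polar form of
  the quadric ([quadric_pair]).  As the rows form a basis and the form is
  nondegenerate, [a = 0].

- Every row has [a_1 a_4 = 0].  Take a row [a] with [a_1 != 0] and a row [b]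
  with [b_4 != 0].  Their product must be a multiple of [b \otimes a], and the
  coefficient of [y^3 x^2], where the Belavin-Drinfeld term appears, leaves,
  together with the conditions on single rows, only two shapes ([corner_pair]):
  [a = (a_1, a_2, 0, 0)], [b = (0, 0, b_3, b_4)], or
  [a = (a_1, 0, a_3, 0)], [b = (0, b_2, 0, b_4)], and in each shape it fixes the
  ratio of the coordinates of [b] in terms of [a].  A row with vanishing ends has
  [x_3 = 0] in the first shape and [x_2 = 0] in the second ([third_vector12],
  [third_vector13]).  Hence all rows satisfy the same nontrivial linear equation,
  [b_4 x_3 = b_3 x_4] or [b_4 x_2 = b_2 x_4], and [A] is singular. *)

Set Implicit Arguments.
Unset Strict Implicit.
Unset Printing Implicit Defensive.

Import GRing.Theory.
Local Open Scope ring_scope.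

Local Notation "a @ k" := (a k%N) (at level 9, k at level 0, only parsing).

(** * Rime matrices in terms of the rows of the change of basis *)

Section RimeRows.
Variable F : fieldType.

Lemma sum_support1 (I : finType) (f : I -> F) (i : I) :
  (forall m, m != i -> f m = 0) -> \sum_m f m = f i.
Proof. by move=> f0; rewrite (bigD1 i) //= big1 ?addr0. Qed.

Lemma sum_support2 (I : finType) (f : I -> F) (i j : I) : i != j ->
  (forall m, m \notin [set i; j] -> f m = 0) -> \sum_m f m = f i + f j.
Proof.
move=> ij f0; rewrite (bigD1 i) //= (bigD1 j) 1?eq_sym //= big1 ?addr0 //.
by move=> m /andP[mi mj]; apply: f0; rewrite !inE negb_or mi.
Qed.

Lemma sum_tens (m n : nat) (f : 'I_(m * n) -> F) :
  \sum_u f u = \sum_i \sum_j f (mxtens_index (i, j)).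
Proof.
rewrite (reindex (@mxtens_index m n)) /=; last first.
  by exists (@mxtens_unindex m n) => u _;
    rewrite (mxtens_indexK, mxtens_unindexK).
rewrite (pair_bigA _ (fun i j => f (mxtens_index (i, j)))).
by apply: eq_bigr => -[i j] _.
Qed.

Lemma tens1mx1 (m n : nat) :
  (1%:M : 'M[F]_m) *t (1%:M : 'M[F]_n) = 1%:M.
Proof.
apply/matrixP => u v.
case: (mxtens_indexP u) => i j; case: (mxtens_indexP v) => k l.
rewrite tensmxE !mxE (can_eq (@mxtens_indexK _ _)) xpair_eqE.
by rewrite -natrM mulnb.
Qed.

Variables (n : nat) (A : 'M[F]_n) (R : 'M[F]_(n * n)).
Hypothesis uA : A \in unitmx.
Hypothesis rimeM : is_rime ((A *t A) *m R *m (invmx A *t invmx A)).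

Local Notation M := ((A *t A) *m R *m (invmx A *t invmx A)).
Local Notation AR i j k l :=
  (((A *t A) *m R) (mxtens_index (i, j)) (mxtens_index (k, l))).

(** Multiplying the conjugated matrix [M] back by [A *t A] expresses each row
of [(A *t A) R] through tensor products of rows of [A]. *)
Lemma tens_row_expansion i j k l :
  AR i j k l = \sum_m \sum_o tens_entry M i j m o * (A m k * A o l).
Proof.
have AM : (A *t A) *m R = M *m (A *t A).
  by rewrite -!mulmxA tensmx_mul mulVmx // tens1mx1 mulmx1.
rewrite {1}AM mxE sum_tens; apply: eq_bigr => m _; apply: eq_bigr => o _.
by rewrite tensmxE.
Qed.

Lemma rime_entry0 i j m o :
  ~~ ([set m; o] \subset [set i; j]) -> tens_entry M i j m o = 0.
Proof. by apply: contraNeq => /rimeM. Qed.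

Lemma rime_square i :
  exists c, forall k l, AR i i k l = c * (A i k * A i l).
Proof.
exists (tens_entry M i i i i) => k l; rewrite tens_row_expansion.
rewrite (sum_support1 (i := i)) => [|m mi]; last first.
  apply: big1 => o _; rewrite rime_entry0 ?mul0r //.
  by rewrite subUset !sub1set !inE orbb negb_and mi.
apply: sum_support1 => o oi; rewrite rime_entry0 ?mul0r //.
by rewrite subUset !sub1set !inE !orbb negb_and oi orbT.
Qed.

Lemma rime_pair i j :
  exists c1 c2 c3 c4, forall k l, AR i j k l =
    c1 * (A i k * A i l) + c2 * (A i k * A j l)
    + c3 * (A j k * A i l) + c4 * (A j k * A j l).
Proof.
have [->|ij] := eqVneq i j.
  have [c Ec] := rime_square j; exists c, 0, 0, 0 => k l.
  by rewrite Ec !mul0r !addr0.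
exists (tens_entry M i j i i), (tens_entry M i j i j),
  (tens_entry M i j j i), (tens_entry M i j j j) => k l.
rewrite tens_row_expansion (sum_support2 ij) => [|m mij]; last first.
  apply: big1 => o _; rewrite rime_entry0 ?mul0r //.
  by rewrite subUset !sub1set (negPf mij).
rewrite !(sum_support2 ij) ?addrA // => m mij;
  by rewrite rime_entry0 ?mul0r // subUset !sub1set (negPf mij) andbF.
Qed.

Lemma unitmx_row_neq0 i : exists k, A i k != 0.
Proof.
apply/existsP; apply: contraLR uA; rewrite negb_exists => /forallP A0.
rewrite -row_free_unit; apply/negP => /row_freeP[B AB].
have /matrixP/(_ i i)/eqP := AB.
rewrite !mxE eqxx big1 ?(eq_sym 0) ?oner_eq0 // => k _.
by move: (A0 k); rewrite negbK => /eqP ->; rewrite mul0r.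
Qed.

End RimeRows.

(** * The relations in coordinates *)

Section Relations.
Variables (F : fieldType) (q p r s : F).
Implicit Types (a b : nat -> F).

(** The coefficient of [y^k x^l] in [f(x) g(y)], where [f] and [g] are the linear
forms with coordinates [a 1, .., a 4] and [b 1, .., b 4]. *)
Definition product_coef (a b : nat -> F) (k l : nat) : F :=
  match k, l with
  | 1%N, 2%N => (p * q)^-1 * a@2 * b@1
  | 2%N, 1%N => p / q * a@1 * b@2 + (1 - q ^- 2) * a@2 * b@1
  | 1%N, 3%N => r^-1 * a@3 * b@1
  | 3%N, 1%N => r / q ^+ 2 * a@1 * b@3 + (1 - q ^- 2) * a@3 * b@1
  | 1%N, 4%N => (p * q * r)^-1 * a@4 * b@1
  | 4%N, 1%N => p * r / q * a@1 * b@4 + (1 - q ^- 2) * a@4 * b@1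
  | 2%N, 3%N => p / (q * s) * a@3 * b@2 + q^-1 * a@4 * b@1
  | 3%N, 2%N => s / (p * q) * a@2 * b@3 + (1 - q ^- 2) * a@3 * b@2
              - r * s / q * a@1 * b@4
  | 2%N, 4%N => s^-1 * a@4 * b@2
  | 4%N, 2%N => s / q ^+ 2 * a@2 * b@4 + (1 - q ^- 2) * a@4 * b@2
  | 3%N, 4%N => s / (p * q * r) * a@4 * b@3
  | 4%N, 3%N => p * r / (q * s) * a@3 * b@4 + (1 - q ^- 2) * a@4 * b@3
  | _, _ => a k * b k
  end.

(** Coordinates are numbered from 1, as in the relations. *)
Definition row_coord (A : 'M[F]_4) (i : 'I_4) (k : nat) : F := A i (inord k.-1).

Lemma yxE (k l : nat) (i j : 'I_4) : (k.-1 < 4)%N -> (l.-1 < 4)%N ->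
  yx F k l 0 (mxtens_index (i, j)) = ((i == k.-1 :> nat) && (j == l.-1 :> nat))%:R.
Proof.
move=> hk hl; rewrite mxE eqxx (can_eq (@mxtens_indexK _ _)) xpair_eqE.
by rewrite -!val_eqE /= !inordK.
Qed.

Lemma sum_ord4 (f : 'I_4 -> F) :
  \sum_(i < 4) f i = f (inord 0) + f (inord 1) + f (inord 2) + f (inord 3).
Proof.
rewrite !big_ord_recl big_ord0 addr0 !addrA.
by congr (_ + _ + _ + _); congr f; apply: val_inj; rewrite /= inordK.
Qed.

Lemma tens_Rhat_entry (A : 'M[F]_4) (i j k l : 'I_4) :
  ((A *t A) *m Rhat q p r s) (mxtens_index (i, j)) (mxtens_index (k, l))
  = product_coef (row_coord A i) (row_coord A j) k.+1 l.+1.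
Proof.
rewrite mxE sum_tens.
under eq_bigr => m _ do under eq_bigr => n _ do
  rewrite tensmxE [Rhat _ _ _ _ _ _]mxE mxtens_indexK.
rewrite /= !sum_ord4 !inordK // /row_coord.
(* Generalizing [yx] keeps [mxE] from expanding it into matrix units before
   [yxE] can evaluate its entries. *)
rewrite /xy; move: (yx F) yxE => Y YE; rewrite !mxE !YE //.
case: k => [[|[|[|[|k]]]] hk] //; case: l => [[|[|[|[|l]]]] hl] //=.
all: rewrite ?(mulr0, addr0, add0r, mulr1, oppr0, subr0) //=.
all: ring.
Qed.

Definition square_fixed (a : nat -> F) : Prop :=
  forall k l : nat, (0 < k <= 4)%N -> (0 < l <= 4)%N ->
    product_coef a a k l = a k * a l.

Definition span_stable (a b : nat -> F) : Prop :=
  exists c1 c2 c3 c4 : F,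
  forall k l : nat, (0 < k <= 4)%N -> (0 < l <= 4)%N ->
    product_coef a b k l =
      c1 * (a k * a l) + c2 * (a k * b l) + c3 * (b k * a l) + c4 * (b k * b l).

Lemma rime_rows (A : 'M[F]_4) : A \in unitmx ->
  is_rime ((A *t A) *m Rhat q p r s *m (invmx A *t invmx A)) ->
  (forall i, square_fixed (row_coord A i)) /\
  (forall i j, span_stable (row_coord A i) (row_coord A j)).
Proof.
move=> uA rimeM.
have entry i j k l : (0 < k <= 4)%N -> (0 < l <= 4)%N ->
    product_coef (row_coord A i) (row_coord A j) k l =
    ((A *t A) *m Rhat q p r s) (mxtens_index (i, j))
      (mxtens_index (inord k.-1, inord l.-1)).
  move=> hk hl; rewrite tens_Rhat_entry.
  by case: k hk l hl => // k hk [] // l hl; rewrite !inordK.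
split=> [i k l hk hl|i j]; last first.
  have [c1 [c2 [c3 [c4 E]]]] := rime_pair uA rimeM i j.
  by exists c1, c2, c3, c4 => k l hk hl; rewrite entry // E.
have [c E] := rime_square uA rimeM i.
suff c1 : c = 1 by rewrite entry // E c1 mul1r.
(* [y^k x^k] occurs in [x^k y^k] only, with coefficient 1. *)
have [k0 x0] := unitmx_row_neq0 uA i.
apply: (mulIf (mulf_neq0 x0 x0)); rewrite mul1r -E tens_Rhat_entry.
have xE : row_coord A i k0.+1 = A i k0 by rewrite /row_coord inord_val.
by rewrite -xE; case: k0 {x0 xE} => [[|[|[|[|]]]]].
Qed.

Hypotheses (q0 : q != 0) (p0 : p != 0) (r0 : r != 0) (s0 : s != 0).
Hypothesis q21 : q ^+ 2 != 1.

Lemma inv_eq1 (c x y : F) : x != 0 -> y != 0 -> c^-1 * y * x = x * y -> c = 1.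
Proof.
move=> x0 y0 E; apply: invr_inj; rewrite invr1.
by apply: (mulIf y0); apply: (mulIf x0); rewrite E mul1r mulrC.
Qed.

(** Closes an equation that is a multiple of a known one, leaving a [ring] goal. *)
Lemma lincomb (c L M X Y : F) : L = M -> X - Y = c * (L - M) -> X = Y.
Proof. by move=> -> E; apply/eqP; rewrite -subr_eq0 E subrr mulr0. Qed.

(** * Single rows *)

Section Fixed.
Variable a : nat -> F.
Hypothesis fa : square_fixed a.

Lemma fixed12 : a@1 != 0 -> a@2 != 0 -> p * q = 1.
Proof. by move=> h h'; apply: (inv_eq1 h h'); apply: (fa (k:=1) (l:=2)). Qed.

Lemma fixed13 : a@1 != 0 -> a@3 != 0 -> r = 1.
Proof. by move=> h h'; apply: (inv_eq1 h h'); apply: (fa (k:=1) (l:=3)). Qed.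

Lemma fixed14 : a@1 != 0 -> a@4 != 0 -> p * q * r = 1.
Proof. by move=> h h'; apply: (inv_eq1 h h'); apply: (fa (k:=1) (l:=4)). Qed.

Lemma fixed24 : a@2 != 0 -> a@4 != 0 -> s = 1.
Proof. by move=> h h'; apply: (inv_eq1 h h'); apply: (fa (k:=2) (l:=4)). Qed.

Lemma fixed34 : a@3 != 0 -> a@4 != 0 -> s = p * q * r.
Proof.
move=> h3 h4; apply: (divIf (mulf_neq0 (mulf_neq0 p0 q0) r0)).
rewrite divff ?mulf_neq0 //.
have E : s / (p * q * r) * a@4 * a@3 = a@3 * a@4 by apply: (fa (k:=3) (l:=4)).
by apply: (mulIf h4); apply: (mulIf h3); rewrite E mul1r mulrC.
Qed.

(** The coefficient of [y^2 x^3], to which [x^4 y^1] contributes through its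
Belavin-Drinfeld term. *)
Lemma fixed23 : a@2 * a@3 * (q * s - p) = s * (a@1 * a@4).
Proof.
have E : p / (q * s) * a@3 * a@2 + q^-1 * a@4 * a@1 = a@2 * a@3
  by apply: (fa (k:=2) (l:=3)).
by apply: (lincomb (c:= - (q * s)) E); field; rewrite q0.
Qed.

Lemma fixed23_ends0 : a@1 * a@4 = 0 -> a@2 != 0 -> a@3 != 0 -> q * s = p.
Proof.
move=> a14 h2 h3; have := fixed23; rewrite a14 mulr0 => /eqP.
by rewrite !mulf_eq0 (negPf h2) (negPf h3) subr_eq0 => /eqP.
Qed.

End Fixed.

Lemma pq1_neq : p * q = 1 -> p <> q.
Proof. by move=> E E'; move: E q21; rewrite E' -expr2 => ->; rewrite eqxx. Qed.

Lemma q2inv_neq1 : 1 - q ^- 2 != 0.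
Proof. by rewrite subr_eq0 eq_sym invr_eq1. Qed.

(** * Rows with a vanishing end *)

(** The coefficients of [y^1 x^1], [y^1 x^4], [y^4 x^4] vanish, so the product is
a multiple of [b \otimes a], the factor being read off from [y^4 x^1].  The
Belavin-Drinfeld term makes [a_1 b_4] appear in the coefficient of [y^3 x^2], so
[a_2 b_3] and [a_3 b_2] are not both zero.  The square conditions then tie the
parameters together so tightly that only one of these products can survive. *)
Lemma corner_pair a b : square_fixed a -> square_fixed b -> span_stable a b ->
  a@1 != 0 -> a@4 = 0 -> b@1 = 0 -> b@4 != 0 ->
  [/\ p * q = 1, r = s, [/\ a@2 != 0, a@3 = 0, b@2 = 0 & b@3 != 0]
    & (1 - q ^- 2) * (a@2 * b@3) = r / q * (a@1 * b@4)]
  \/ [/\ r = 1, s = 1, [/\ a@2 = 0, a@3 != 0, b@2 != 0 & b@3 = 0]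
    & (1 - q ^- 2) * (a@3 * b@2) = q^-1 * (a@1 * b@4)].
Proof.
move=> fa fb [c1 [c2 [c3 [c4 E]]]] a1 a4 b1 b4.
have c10 : c1 = 0.
  have /eqP := E 1%N 1%N isT isT; rewrite /= b1 !(mulr0, mul0r, addr0) eq_sym.
  by rewrite !mulf_eq0 (negPf a1) !orbF => /eqP.
have c20 : c2 = 0.
  have /eqP := E 1%N 4%N isT isT; rewrite /= c10 a4 b1 !(mulr0, mul0r, addr0, add0r) eq_sym.
  by rewrite !mulf_eq0 (negPf a1) (negPf b4) !orbF => /eqP.
have c40 : c4 = 0.
  have /eqP := E 4%N 4%N isT isT; rewrite /= a4 !(mulr0, mul0r, addr0, add0r) eq_sym.
  by rewrite !mulf_eq0 (negPf b4) !orbF => /eqP.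
have c3E : c3 = p * r / q.
  have := E 4%N 1%N isT isT; rewrite /= a4 b1 !(mulr0, mul0r, addr0, add0r).
  move=> E41; apply: (mulIf (mulf_neq0 a1 b4)); apply: (lincomb (c := -1) E41); ring.
have E32 : c3 * (b@3 * a@2) = s / (p * q) * a@2 * b@3
    + (1 - q ^- 2) * a@3 * b@2 - r * s / q * a@1 * b@4.
  by have := E 3%N 2%N isT isT; rewrite /= c10 c20 c40 !mul0r !add0r addr0 => ->.
have ab1 : a@1 * b@4 != 0 by rewrite mulf_neq0.
have a14 : a@1 * a@4 = 0 by rewrite a4 mulr0.
have b14 : b@1 * b@4 = 0 by rewrite b1 mul0r.
have [a23|] := boolP ((a@2 != 0) && (b@3 != 0)).
  left; have [a2 b3] := andP a23.
  have pq : p * q = 1 := fixed12 fa a1 a2.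
  have rs : r = s by rewrite (fixed34 fb b3 b4) pq mul1r.
  have b2 : b@2 = 0.
    apply/eqP/negP => /negP b2; have s1 := fixed24 fb b2 b4.
    by have := fixed23_ends0 fb b14 b2 b3; rewrite s1 mulr1 => /esym/(pq1_neq pq).
  have a3 : a@3 = 0.
    apply/eqP/negP => /negP a3; have r1 := fixed13 fa a1 a3.
    have := fixed23_ends0 fa a14 a2 a3.
    by rewrite -rs r1 mulr1 => /esym/(pq1_neq pq).
  split=> //; move: E32; rewrite c3E a3 -rs pq.
  have -> : p = q^-1 by apply: (mulIf q0); rewrite pq mulVf.
  move=> E32; apply: (lincomb (c := - r^-1) E32); field; by rewrite oner_eq0 r0 q0.
rewrite negb_and !negbK => a2b3; right.
have a2b3E : a@2 * b@3 = 0 by apply/eqP; rewrite mulf_eq0.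
have E32' : (1 - q ^- 2) * (a@3 * b@2) = r * s / q * (a@1 * b@4).
  apply: subr0_eq; transitivity ((c3 - s / (p * q)) * (a@2 * b@3)).
    by apply: (lincomb (c := -1) E32); ring.
  by rewrite a2b3E mulr0.
have : a@3 * b@2 != 0.
  apply/negP => /eqP h; move/eqP: E32'; rewrite h mulr0 eq_sym.
  by rewrite (negPf (mulf_neq0 _ ab1)) // mulf_neq0 ?invr_neq0 // mulf_neq0.
rewrite mulf_eq0 negb_or => /andP[a3 b2].
have r1 : r = 1 := fixed13 fa a1 a3.
have s1 : s = 1 := fixed24 fb b2 b4.
have b3 : b@3 = 0.
  apply/eqP/negP => /negP b3; have := fixed34 fb b3 b4.
  rewrite r1 s1 mulr1 => /esym pq.
  by have := fixed23_ends0 fb b14 b2 b3; rewrite s1 mulr1 => /esym/(pq1_neq pq).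
have a2 : a@2 = 0.
  apply/eqP/negP => /negP a2; have pq := fixed12 fa a1 a2.
  by have := fixed23_ends0 fa a14 a2 a3; rewrite s1 mulr1 => /esym/(pq1_neq pq).
by split=> //; rewrite E32' r1 s1 !mul1r.
Qed.

(** If [h_3 != 0], the product is a multiple of [h \otimes a], but the factor is
[r / q^2] by the coefficient of [y^3 x^1] and [r] by that of [y^3 x^2]. *)
Lemma third_vector12 a h : p * q = 1 -> r = s -> span_stable a h ->
  a@1 != 0 -> a@2 != 0 -> a@3 = 0 -> a@4 = 0 -> h@1 = 0 -> h@4 = 0 -> h@3 = 0.
Proof.
move=> pq rs [c1 [c2 [c3 [c4 E]]]] a1 a2 a3 a4 h1 h4.
apply/eqP/negP => /negP h3.
have c10 : c1 = 0.
  have /eqP := E 1%N 1%N isT isT; rewrite /= h1 !(mulr0, mul0r, addr0) eq_sym.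
  by rewrite !mulf_eq0 (negPf a1) !orbF => /eqP.
have c20 : c2 = 0.
  have /eqP := E 1%N 3%N isT isT.
  rewrite /= c10 a3 h1 !(mulr0, mul0r, addr0, add0r) eq_sym.
  by rewrite !mulf_eq0 (negPf a1) (negPf h3) !orbF => /eqP.
have c40 : c4 = 0.
  have /eqP := E 3%N 3%N isT isT; rewrite /= a3 !(mulr0, mul0r, addr0, add0r) eq_sym.
  by rewrite !mulf_eq0 (negPf h3) !orbF => /eqP.
have c3E : c3 = r / q ^+ 2.
  have := E 3%N 1%N isT isT; rewrite /= a3 h1 !(mulr0, mul0r, addr0, add0r).
  move=> E3; apply: (mulIf (mulf_neq0 a1 h3)); apply: (lincomb (c := -1) E3); ring.
have c3E' : c3 = r.
  have := E 3%N 2%N isT isT.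
  rewrite /= c10 c20 c40 a3 h4 pq divr1 -rs !(mulr0, mul0r, addr0, add0r, subr0).
  move=> E3; apply: (mulIf (mulf_neq0 a2 h3)); apply: (lincomb (c := -1) E3); ring.
move: c3E'; rewrite c3E => /(canRL (mulKf r0)); rewrite mulVf // => /(congr1 (@GRing.inv F)).
by rewrite invrK invr1 => /eqP; rewrite (negPf q21).
Qed.

(** If [h_2 != 0], the product is a multiple of [h \otimes a], which has no
[y^3 x^2] term since [a_2 = 0]; yet the Hecke term [(1 - q^-2) y^3 x^2] of
[x^3 y^2] gives it one. *)
Lemma third_vector13 a h : span_stable a h ->
  a@1 != 0 -> a@2 = 0 -> a@3 != 0 -> a@4 = 0 -> h@1 = 0 -> h@4 = 0 -> h@2 = 0.
Proof.
move=> [c1 [c2 [c3 [c4 E]]]] a1 a2 a3 a4 h1 h4.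
apply/eqP/negP => /negP h2.
have c10 : c1 = 0.
  have /eqP := E 1%N 1%N isT isT; rewrite /= h1 !(mulr0, mul0r, addr0) eq_sym.
  by rewrite !mulf_eq0 (negPf a1) !orbF => /eqP.
have c40 : c4 = 0.
  have /eqP := E 2%N 2%N isT isT; rewrite /= a2 !(mulr0, mul0r, addr0, add0r) eq_sym.
  by rewrite !mulf_eq0 (negPf h2) !orbF => /eqP.
have c20 : c2 = 0.
  have /eqP := E 1%N 2%N isT isT.
  rewrite /= c10 a2 h1 !(mulr0, mul0r, addr0, add0r) eq_sym.
  by rewrite !mulf_eq0 (negPf a1) (negPf h2) !orbF => /eqP.
have /eqP := E 3%N 2%N isT isT.
rewrite /= c10 c20 c40 a2 h4 !(mulr0, mul0r, addr0, add0r, subr0).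
by rewrite !mulf_eq0 (negPf q2inv_neq1) (negPf a3) (negPf h2).
Qed.

(** * Rows with two nonzero ends *)

(** Up to scaling by [q - 1/q], the quadric consists of the 2 x 2 matrices
[(a_1, a_2; a_3, a_4)] of rank at most 1, and the pair condition makes [b] arise
from [a] by scaling its rows or its columns: projectively, [b] lies on one of the
two lines of the quadric through [a], which is why it is orthogonal to [a]. *)
Lemma quadric_pair a b : p * q = 1 -> r = 1 -> s = 1 ->
  square_fixed a -> span_stable a b -> a@1 != 0 -> a@4 != 0 ->
  a@1 * b@4 + a@4 * b@1 = (q - q^-1) * (a@2 * b@3 + a@3 * b@2).
Proof.
move=> pq r1 s1 fa [c1 [c2 [c3 [c4 E]]]] a1 a4.
have pE : p = q^-1 by apply: (mulIf q0); rewrite pq mulVf.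
have Q : a@1 * a@4 = (q - q^-1) * (a@2 * a@3).
  by have := fixed23 fa; rewrite s1 mulr1 mul1r pE mulrC => ->.
(* For these parameters f(x) g(y) is b \otimes a plus a tensor T whose column l is
   a combination of a and b, with coefficient m l on b.  If the first entry of
   this column vanishes, the column is proportional to a_1 b - b_1 a, whose
   entries are the minors D 1 k. *)
pose m l := (c3 - 1) * a l + c4 * b l.
pose D k l := a k * b l - a l * b k.
have col k l : (0 < k <= 4)%N -> (0 < l <= 4)%N ->
    product_coef a b 1 l = a l * b@1 ->
    m l * D 1%N k = a@1 * (product_coef a b k l - a l * b k).
  move=> hk hl El; have := E 1%N l isT hl; rewrite El => E1.
  rewrite (E k l hk hl) /m /D.
  by apply: (lincomb (c := a k) E1); ring.
have p12 : product_coef a b 1 2 = a@2 * b@1 by rewrite /= pq invr1 mul1r.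
have p13 : product_coef a b 1 3 = a@3 * b@1 by rewrite /= r1 invr1 mul1r.
have m22 : m 2%N * D 1%N 2%N = 0 by rewrite col //= subrr mulr0.
have m33 : m 3%N * D 1%N 3%N = 0 by rewrite col //= subrr mulr0.
have m24 : m 2%N * D 1%N 4%N = - ((1 - q ^- 2) * a@1 * D 2%N 4%N).
  by rewrite col //= s1 /D; field; rewrite ?oner_eq0 ?q0.
have m34 : m 3%N * D 1%N 4%N = - ((1 - q ^- 2) * a@1 * D 3%N 4%N).
  by rewrite col //= s1 r1 pE /D; field; rewrite ?oner_eq0 ?q0.
have m23 : m 2%N * D 1%N 3%N = a@1 * ((1 - q ^- 2) * a@3 * b@2 - a@1 * b@4 / q).
  by rewrite col //= s1 r1 pE; field; rewrite ?oner_eq0 ?q0.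
have m32 : m 3%N * D 1%N 2%N = a@1 * (a@4 * b@1 / q - (1 - q ^- 2) * a@3 * b@2).
  by rewrite col //= ?s1 ?r1 pE; field; rewrite ?oner_eq0 ?q0.
(* The entries (2,3) and (3,2) of T add up to - D 1 4 / q, hence cannot both
   vanish when D 1 4 does not. *)
have D14_0 : m 2%N * D 1%N 3%N = 0 -> m 3%N * D 1%N 2%N = 0 -> D 1%N 4%N = 0.
  move=> /eqP; rewrite m23 mulf_eq0 (negPf a1) /= => /eqP S32.
  move=> /eqP; rewrite m32 mulf_eq0 (negPf a1) /= => /eqP S23.
  apply: (mulIf (invr_neq0 q0)); rewrite mul0r /D.
  transitivity (- ((1 - q ^- 2) * a@3 * b@2 - a@1 * b@4 / q)
    - (a@4 * b@1 / q - (1 - q ^- 2) * a@3 * b@2)); first by ring.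
  by rewrite S32 S23 !oppr0 addr0.
have prop k l : a k != 0 -> D k l = 0 -> b l = b k / a k * a l.
  by move=> ak /eqP; rewrite subr_eq0 => /eqP Dkl; apply: (mulfI ak); rewrite Dkl; field.
have propV k l : a l != 0 -> D k l = 0 -> b k = b l / a l * a k.
  by move=> al /eqP; rewrite subr_eq0 => /eqP Dkl; apply: (mulfI al); rewrite -Dkl; field.
have la : (1 - q ^- 2) * a@1 != 0 by rewrite mulf_neq0 // q2inv_neq1.
(* In each case b is a after scaling rows (pairs {1,2} and {3,4}) or columns
   (pairs {1,3} and {2,4}), or both by the same factor, and the claim is a multiple
   of Q. *)
have [D14|D14] := eqVneq (D 1%N 4%N) 0.
  have D24 : D 2%N 4%N = 0.
    by apply/eqP; move/eqP: m24; rewrite D14 mulr0 eq_sym oppr_eq0 mulf_eq0 (negPf la).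
  have D34 : D 3%N 4%N = 0.
    by apply/eqP; move/eqP: m34; rewrite D14 mulr0 eq_sym oppr_eq0 mulf_eq0 (negPf la).
  rewrite (propV _ _ a4 D14) (propV _ _ a4 D24) (propV _ _ a4 D34).
  by apply: (lincomb (c := 2%:R * (b@4 / a@4)) Q); field; rewrite a4 q0.
have [D12|D12] := eqVneq (D 1%N 2%N) 0.
  have [D13|D13] := eqVneq (D 1%N 3%N) 0.
    by case/eqP: D14; apply: D14_0; rewrite ?D13 ?D12 mulr0.
  have D34 : D 3%N 4%N = 0.
    move/eqP: m33; rewrite mulf_eq0 (negPf D13) orbF => /eqP m3.
    by apply/eqP; move/eqP: m34; rewrite m3 mul0r eq_sym oppr_eq0 mulf_eq0 (negPf la).
  rewrite (prop _ _ a1 D12) (propV _ _ a4 D34).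
  by apply: (lincomb (c := b@4 / a@4 + b@1 / a@1) Q); field; rewrite a1 a4 q0.
have D24 : D 2%N 4%N = 0.
  move/eqP: m22; rewrite mulf_eq0 (negPf D12) orbF => /eqP m2.
  by apply/eqP; move/eqP: m24; rewrite m2 mul0r eq_sym oppr_eq0 mulf_eq0 (negPf la).
have D13 : D 1%N 3%N = 0.
  have [//|D13] := eqVneq (D 1%N 3%N) 0.
  move/eqP: m33; rewrite mulf_eq0 (negPf D13) orbF => /eqP m3.
  move/eqP: m22; rewrite mulf_eq0 (negPf D12) orbF => /eqP m2.
  by case/eqP: D14; apply: D14_0; rewrite ?m2 ?m3 mul0r.
rewrite (prop _ _ a1 D13) (propV _ _ a4 D24).
by apply: (lincomb (c := b@4 / a@4 + b@1 / a@1) Q); field; rewrite a1 a4 q0.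
Qed.

(** * No change of basis rimes the matrix *)

Lemma coord_kernel0 (A : 'M[F]_4) (c1 c2 c3 c4 : F) : A \in unitmx ->
  (forall i, c1 * row_coord A i 1 + c2 * row_coord A i 2
     + c3 * row_coord A i 3 + c4 * row_coord A i 4 = 0) ->
  [/\ c1 = 0, c2 = 0, c3 = 0 & c4 = 0].
Proof.
move=> uA Ac; pose c (k : 'I_4) := nth 0 [:: c1; c2; c3; c4] k.
have col0 : \col_k c k = 0.
  rewrite -[LHS](mulKmx uA) [A *m _](_ : _ = 0) ?mulmx0 //.
  apply/matrixP => i j; rewrite !mxE -[RHS](Ac i) sum_ord4 !mxE /c !inordK //=.
  by rewrite /row_coord; ring.
have ck0 k : c (inord k) = 0 by have /matrixP/(_ (inord k) 0) := col0; rewrite !mxE.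
by split; [have := ck0 0%N|have := ck0 1%N|have := ck0 2%N|have := ck0 3%N];
  rewrite /c inordK.
Qed.

Lemma not_rime (A : 'M[F]_4) : A \in unitmx ->
  ~ is_rime ((A *t A) *m Rhat q p r s *m (invmx A *t invmx A)).
Proof.
move=> uA /(rime_rows uA)[fx st].
have singular c1 c2 c3 c4 := @coord_kernel0 A c1 c2 c3 c4 uA.
have [i f1] : exists i, row_coord A i 1 != 0.
  apply/existsP; apply: contraT; rewrite negb_exists => /forallP x0.
  case: (singular 1 0 0 0) => [i|/eqP]; last by rewrite oner_eq0.
  by move/(_ i): x0; rewrite negbK => /eqP /= ->; ring.
have [j g4] : exists j, row_coord A j 4 != 0.
  apply/existsP; apply: contraT; rewrite negb_exists => /forallP x0.
  case: (singular 0 0 0 1) => [j|_ _ _ /eqP]; last by rewrite oner_eq0.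
  by move/(_ j): x0; rewrite negbK => /eqP /= ->; ring.
have [/existsP[m /andP[m1 m4]]|] :=
    boolP [exists m, (row_coord A m 1 != 0) && (row_coord A m 4 != 0)].
  have pqr := fixed14 (fx m) m1 m4; set a := row_coord A m in m1 m4 pqr.
  have : a@2 * a@3 * (q * s - p) != 0.
    by rewrite (fixed23 (fx m)) !mulf_neq0.
  rewrite !mulf_eq0 !negb_or => /andP[/andP[a2 a3] _].
  have pq := fixed12 (fx m) m1 a2; have r1 := fixed13 (fx m) m1 a3.
  have s1 := fixed24 (fx m) a2 m4.
  case: (singular a@4 (- ((q - q^-1) * a@3)) (- ((q - q^-1) * a@2)) a@1).
    move=> n; have B := quadric_pair pq r1 s1 (fx m) (st m n) m1 m4.
    by apply: (lincomb (c := 1) B); rewrite -/a; ring.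
  by move=> a40; rewrite a40 eqxx in m4.
rewrite negb_exists => /forallP ends.
have ends4 m : row_coord A m 1 != 0 -> row_coord A m 4 = 0.
  by move=> m1; move: (ends m); rewrite m1 /= negbK => /eqP.
have ends1 m : row_coord A m 4 != 0 -> row_coord A m 1 = 0.
  by move=> m4; move: (ends m); rewrite m4 andbT negbK => /eqP.
have f4 := ends4 _ f1; have g1 := ends1 _ g4.
have corner m n : row_coord A m 1 != 0 -> row_coord A n 4 != 0 -> _ :=
  fun m1 n4 => corner_pair (fx m) (fx n) (st m n) m1 (ends4 m m1) (ends1 n n4) n4.
have qinv1 := q2inv_neq1.
have [[pq rs [f2 f3 g2 g3] fg]|[r1 s1 [f2 f3 g2 g3] fg]] := corner _ _ f1 g4.
  case: (singular 0 0 (row_coord A j 4) (- row_coord A j 3)) => [n|_ _ /eqP]; last first.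
    by rewrite (negPf g4).
  have [x4|x4] := eqVneq (row_coord A n 4) 0; first have [x1|x1] := eqVneq (row_coord A n 1) 0.
  - by rewrite (third_vector12 pq rs (st i n)) // x4; ring.
  - have [[_ _ [_ x3 _ _] _]|[_ _ [_ _ _ g30] _]] := corner _ _ x1 g4.
      by rewrite x3 x4; ring.
    by rewrite g30 eqxx in g3.
  have [[_ _ _ fx']|[_ _ [f20 _ _ _] _]] := corner _ _ f1 x4; last first.
    by rewrite f20 eqxx in f2.
  apply: (mulfI (mulf_neq0 qinv1 f2)); rewrite mulr0.
  transitivity (row_coord A j 4 * ((1 - q ^- 2) * (row_coord A i 2 * (row_coord A n 3)))
     - (row_coord A n 4) * ((1 - q ^- 2) * (row_coord A i 2 * row_coord A j 3))); first by ring.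
  by rewrite fx' fg; ring.
case: (singular 0 (row_coord A j 4) 0 (- row_coord A j 2)) => [n|_ /eqP]; last first.
  by rewrite (negPf g4).
have [x4|x4] := eqVneq (row_coord A n 4) 0; first have [x1|x1] := eqVneq (row_coord A n 1) 0.
- by rewrite (third_vector13 (st i n)) // x4; ring.
- have [[_ _ [_ _ g20 _] _]|[_ _ [x2 _ _ _] _]] := corner _ _ x1 g4.
    by rewrite g20 eqxx in g2.
  by rewrite x2 x4; ring.
have [[_ _ [_ f30 _ _] _]|[_ _ _ fx']] := corner _ _ f1 x4.
  by rewrite f30 eqxx in f3.
apply: (mulfI (mulf_neq0 qinv1 f3)); rewrite mulr0.
transitivity (row_coord A j 4 * ((1 - q ^- 2) * (row_coord A i 3 * (row_coord A n 2)))
   - (row_coord A n 4) * ((1 - q ^- 2) * (row_coord A i 3 * row_coord A j 2))); first by ring.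
by rewrite fx' fg; ring.
Qed.

End Relations.

Local Open Scope complex_scope.

Theorem mainTheorem15 (R : realType) (q p r s : R[i])
    (hq : q != 0) (hp : p != 0) (hr : r != 0) (hs : s != 0)
    (hq2 : q ^+ 2 != 1) :
  ~ exists A : 'M[R[i]]_4, A \in unitmx /\
      is_rime ((A *t A) *m Rhat q p r s *m (invmx A *t invmx A)).
Proof. by case=> A [uA]; exact: not_rime. Qed.
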